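(* Let $D$ be the closed unit disk and consider, on the represented space $\mathcal C^\omega(D)$ of analytic functions on $D$, the partial functions defined on those $f\in\mathcal C^\omega(D)$ that are restrictions to $D$ of polynomials $P\in\mathbb C[X]$: $\operatorname{dbnd}_\omega:\subseteq\mathcal C^\omega(D)\rightrightarrows\mathbb N$, where $n$ is a valid output iff $n\ge\deg P$; and $\deg_\omega:\subseteq\mathcal C^\omega(D)\to\mathbb N$, $f\mapsto\deg P$. Then $\mathrm C_{\mathbb N}\equiv_W\operatorname{dbnd}_\omega\equiv_W\deg_\omega$.
   Context: Represented spaces: sets with partial surjections from $\mathbb{N}^{\mathbb{N}}$. A realizer of $f:\subseteq\mathbf X\rightrightarrows\mathbf Y$ is a partial $F$ on $\mathbb{N}^{\mathbb{N}}$ with $\delta_{\mathbf Y}(F(p))\in f(\delta_{\mathbf X}(p))$ whenever $\delta_{\mathbf X}(p)\in\operatorname{dom}f$. $f\le_W g$ iff there are computable partial $H:\subseteq\mathbb{N}^{\mathbb{N}}\to\mathbb{N}^{\mathbb{N}}$, $K:\subseteq\mathbb{N}^{\mathbb{N}}\times\mathbb{N}^{\mathbb{N}}\to\mathbb{N}^{\mathbb{N}}$ with $p\mapsto K(p,G(H(p)))$ realizing $f$ for every realizer $G$ of $g$; $\equiv_W$ is reducibility both ways. $\mathbb N$ is represented by $p\mapsto p(0)$; $\mathcal A(\mathbb N)$: $p$ names $A$ iff $\mathbb N\setminus A=\{p(n)-1\mid p(n)>0\}$; $\mathrm C_{\mathbb N}$ maps a nonempty $A\in\mathcal A(\mathbb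 N)$ to any element of $A$. $\mathcal C(D)$: continuous $D\to\mathbb C$, with metric representation ($p$ names $f$ iff $\|f-q_{p(n)}\|_\infty<2^{-n}$ for all $n$, $(q_n)$ a standard enumeration of polynomials with rational coefficients). Let $U_m$ be the open disk of radius $2^{1/(m+1)}$ around $0$. $\mathcal C^\omega(D)$: the analytic functions on $D$, where $q$ is a name of $f$ iff $f$ extends analytically to the closure of $U_{q(0)}$, this extension is bounded in absolute value by $q(0)$, and $n\mapsto q(n+1)$ is a $\mathcal C(D)$-name of $f$. *)

(* Defs.v *)
From HB Require Import structures.
From mathcomp Require Import all_boot all_order all_algebra.
From mathcomp Require Import complex.
From mathcomp Require Import all_classical all_reals all_analysis.

Set Implicit Arguments.
Unset Strict Implicit.
Unset Printing Implicit Defensive.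

Import Order.TTheory GRing.Theory Num.Theory.
Import numFieldNormedType.Exports.
Import Normc.

Local Open Scope classical_set_scope.
Local Open Scope nat_scope.

Definition baire := nat -> nat.

(* Kleene's mu-recursive functions relative to an oracle [p : baire].
   [eval p c v n] means that the program [c], run with oracle [p] on the
   argument list [v], halts with value [n]. *)
Inductive code :=
| Zero
| Succ
| Proj of nat
| Oracle
| Comp of code & seq code
| Rec of code & code
| Mu of code.

Inductive eval (p : baire) : code -> seq nat -> nat -> Prop :=
| eval_zero v : eval p Zero v 0
| eval_succ n v : eval p Succ (n :: v) n.+1
| eval_proj i v : eval p (Proj i) v (nth 0 v i)
| eval_oracle n v : eval p Oracle (n :: v) (p n)
| eval_comp f gs v ws n :
    evals p gs v ws -> eval p f ws n -> eval p (Comp f gs) v n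
| eval_rec0 f g v n : eval p f v n -> eval p (Rec f g) (0 :: v) n
| eval_recS f g m v k n :
    eval p (Rec f g) (m :: v) k -> eval p g [:: m, k & v] n ->
    eval p (Rec f g) (m.+1 :: v) n
| eval_mu f v m (k : nat -> nat) :
    (forall i, i < m -> eval p f (i :: v) (k i).+1) ->
    eval p f (m :: v) 0 -> eval p (Mu f) v m
with evals (p : baire) : seq code -> seq nat -> seq nat -> Prop :=
| evals_nil v : evals p [::] v [::]
| evals_cons g gs v w ws :
    eval p g v w -> evals p gs v ws -> evals p (g :: gs) v (w :: ws).

(* A partial function on Baire space is computable if a single program computes
   F(p)(n) from n with oracle p, for all p in dom F; the behaviour of the
   program outside dom F is irrelevant. *)
Definition computable1 (F : baire -> option baire) : Prop :=
  exists c : code, forall p r, F p = Some r ->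
    forall n, eval p c [:: n] (r n).

Definition join (p q : baire) : baire :=
  fun n => if odd n then q n./2 else p n./2.

Definition computable2 (K : baire -> baire -> option baire) : Prop :=
  exists c : code, forall p q r, K p q = Some r ->
    forall n, eval (join p q) c [:: n] (r n).

(* The representation is given by its graph: [names p x] iff delta(p) = x.
   Surjectivity of delta is not recorded: neither realizers nor Weihrauch
   reductions refer to it. *)
Record repSpace := RepSpace {
  carrier :> Type;
  names : baire -> carrier -> Prop;
  names_fun : forall p x y, names p x -> names p y -> x = y
}.
Arguments names {_} _ _.

(* partial multivalued functions, with domain {x | f x is nonempty} *)
Definition multifun (X Y : repSpace) := X -> set Y.

Definition realizer (X Y : repSpace) (F : baire -> option baire)
    (f : multifun X Y) : Prop :=
  forall p x, names p x -> f x !=set0 ->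
    exists r y, [/\ F p = Some r, names r y & f x y].

Definition weihrauch_le (X Y Z W : repSpace)
    (f : multifun X Y) (g : multifun Z W) : Prop :=
  exists (H : baire -> option baire) (K : baire -> baire -> option baire),
    [/\ computable1 H, computable2 K &
        forall G, realizer G g ->
          realizer (fun p => obind (fun h => obind (K p) (G h)) (H p)) f].

Definition weihrauch_equiv (X Y Z W : repSpace)
    (f : multifun X Y) (g : multifun Z W) : Prop :=
  weihrauch_le f g /\ weihrauch_le g f.

Definition nat_names (p : baire) (n : nat) : Prop := p 0 = n.

Lemma nat_names_fun p m n : nat_names p m -> nat_names p n -> m = n.
Proof. by move=> <- <-. Qed.

Definition natSpace : repSpace := RepSpace nat_names_fun.

Definition closed_names (p : baire) (A : set nat) : Prop :=
  ~` A = [set k | exists2 n, 0 < p n & k = p n - 1].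

Lemma closed_names_fun p A B : closed_names p A -> closed_names p B -> A = B.
Proof. by move=> pA pB; apply: setC_inj; rewrite pA pB. Qed.

Definition closedNatSpace : repSpace := RepSpace closed_names_fun.

Definition C_nat : multifun closedNatSpace natSpace :=
  fun A => [set n | A n].

Local Open Scope ring_scope.
Local Open Scope complex_scope.

Section AnalyticFunctions.
Variable R : realType.

Definition closed_disk : set R[i] := [set z | `|z| <= 1].

(* The topology on the complex plane is that of the normed module [R[i]^o], in
   which the radius of a ball is an element of [R[i]]. *)
Definition U (m : nat) : set R[i] :=
  ball (0 : R[i]^o) (2 `^ (m.+1%:R^-1) : R)%:C.

Definition clU (m : nat) : set R[i] := @closure R[i]^o (U m).

Definition analytic_at (g : R[i] -> R[i]) (z0 : R[i]) : Prop :=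
  exists (a : nat -> R[i]) (r : R), 0 < r /\
    forall z, `|z - z0| < r%:C ->
      series (fun k => a k * (z - z0) ^+ k : R[i]^o) @ \oo --> (g z : R[i]^o).

(* [g] is analytic in a neighbourhood of [S] and extends [f]; the values of [g]
   away from [S] and the disk are irrelevant. *)
Definition analytic_ext (S : set R[i]) (f : closed_disk -> R[i])
    (g : R[i] -> R[i]) : Prop :=
  (forall z, S z -> analytic_at g z) /\ (forall z, g (val z) = f z).

(* Enumeration of the polynomials with coefficients in Q(i), as functions on
   the plane.  The space of continuous functions D -> C with the supremum norm
   requires polynomials in the two real coordinates (polynomials in z alone are
   only dense in the disk algebra); over Q(i) these are exactly the polynomials
   in z and its conjugate, and the coding uses the latter.  [CodeSeq.decode] is
   a bijection from nat to seq nat, used for the list of monomials and again for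
   the data [:: a; b; c; d; e; j; k] of the monomial
   ((a - b) + (c - d) i) / (e + 1) * z^j * conj(z)^k. *)
Definition rat_monomial (n : nat) (z : R[i]) : R[i] :=
  let s k := nth 0%N (CodeSeq.decode n) k in
  (((s 0%N)%:R - (s 1%N)%:R) +i* ((s 2%N)%:R - (s 3%N)%:R)) / (s 4%N).+1%:R
    * z ^+ s 5%N * conjc z ^+ s 6%N.

Definition rat_poly (n : nat) (z : R[i]) : R[i] :=
  \sum_(e <- CodeSeq.decode n) rat_monomial e z.

Definition sup_dist (f : closed_disk -> R[i]) (g : R[i] -> R[i]) : \bar R :=
  ereal_sup [set (normc (f z - g (val z)))%:E | z in [set: closed_disk]].

Definition cont_names (p : baire) (f : closed_disk -> R[i]) : Prop :=
  forall n, (sup_dist f (rat_poly (p n)) < (2^-1 ^+ n)%:E)%E.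

Definition analyticD : Type :=
  {f : closed_disk -> R[i] | exists g, analytic_ext closed_disk f g}.

Definition analytic_names (q : baire) (f : analyticD) : Prop :=
  (exists g, analytic_ext (clU (q 0%N)) (sval f) g /\
     forall z, clU (q 0%N) z -> `|g z| <= (q 0%N)%:R)
  /\ cont_names (fun n => q n.+1) (sval f).

Lemma cont_names_fun p f g : cont_names p f -> cont_names p g -> f = g.
Proof.
have near h z n : cont_names p h ->
    normc (h z - rat_poly (p n) (val z)) <= 2^-1 ^+ n.
  move=> ph; rewrite -lee_fin; apply: le_trans (ltW (ph n)).
  by apply: ereal_sup_ubound; exists z.
move=> pf pg; apply/funext => z; apply/eqP; rewrite -subr_eq0; apply/eqP.
apply: eq0_normc; apply/eqP; rewrite eq_le; apply/andP; split; last first.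
  by case: (_ - _) => ? ? /=; rewrite sqrtr_ge0.
have small n : normc (f z - g z) <= 2 * 2^-1 ^+ n.
  have -> : f z - g z = (f z - rat_poly (p n) (val z))
      + - (g z - rat_poly (p n) (val z)) by rewrite opprB addrA subrK.
  by rewrite (le_trans (le_normcD _ _))// normcN mulr2n mulrDl mul1r lerD// near.
have cvg0 : (fun n => 2 * 2^-1 ^+ n : R) @ \oo --> (0 : R).
  rewrite -[X in _ --> X](mulr0 (2 : R)); apply: cvgMl_tmp; apply: cvg_expr.
  by rewrite ger0_norm ?invr_ge0// invf_lt1// ltr1n.
rewrite -(cvg_lim _ cvg0)//; apply: limr_ge; first by apply/cvg_ex; exists 0.
exact: nearW.
Qed.

Lemma analytic_names_fun q f g :
  analytic_names q f -> analytic_names q g -> f = g.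
Proof.
case: f g => [f hf] [g hg] [_ /= qf] [_ /= qg]; move: hf hg.
by rewrite (cont_names_fun qf qg) => hf hg; congr exist; exact: Prop_irrelevance.
Qed.

Definition analyticSpace : repSpace := RepSpace analytic_names_fun.

(* [f] is the restriction to the disk of the polynomial [P] *)
Definition poly_restr (f : analyticD) (P : {poly R[i]}) : Prop :=
  forall z : closed_disk, sval f z = P.[val z].

(* [(size P).-1] is the degree, with the convention deg 0 = 0. *)
Definition dbnd_omega : multifun analyticSpace natSpace :=
  fun f => [set n | exists2 P, poly_restr f P & ((size P).-1 <= n)%N].

Definition deg_omega : multifun analyticSpace natSpace :=
  fun f => [set n | exists2 P, poly_restr f P & n = (size P).-1].

End AnalyticFunctions.

Arguments dbnd_omega : clear implicits.
Arguments deg_omega : clear implicits.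

(* Main.v *)
(* Both dbnd and deg lie between C_N and itself.

   deg <= C_N: a name of f approximates f on the disk by polynomials in z and
   its conjugate.  The k-th Fourier coefficient on the unit circle of the t-th
   approximation differs from the k-th coefficient a_k of P by at most 2^-t, so
   "a_k <> 0" is semidecidable.  The codes of pairs (n, m) such that n = 0 or
   the precision m certifies a_n <> 0, and such that a_k = 0 for all k > n, form
   a closed set; any element of it yields the degree.

   C_N <= dbnd: while the complement of A is enumerated, keep the least
   candidate c for an element of A that was not yet seen to fail, moving to
   c + 1 when c is enumerated.  With d_k = 1 if the candidate moves at stage k
   and d_k = 0 otherwise, the polynomial sum_k d_k (z / 4)^(k+1) is bounded by 3
   on |z| <= 3, and after a number of stages bounding its degree the candidate
   is final. *)
Require Import Defs.
From mathcomp Require Import all_boot all_order all_algebra.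
From mathcomp Require Import cyclic separable cyclotomic.
From mathcomp Require Import complex zify ring lra.
From mathcomp Require Import all_classical all_reals all_analysis.
(* Analysis also defines an [eval]; the one of Defs is meant throughout. *)
Import Defs.

Set Implicit Arguments.
Unset Strict Implicit.
Unset Printing Implicit Defensive.

Import Order.TTheory GRing.Theory Num.Theory.
Import numFieldNormedType.Exports.
Import Normc.

Local Open Scope classical_set_scope.
Local Open Scope nat_scope.

(** * Oracle computability *)

Scheme eval_mut := Minimality for eval Sort Prop
  with evals_mut := Minimality for evals Sort Prop.

(** Composition of relative computations: each oracle query becomes a call to [c0]. [Proj 0] passes
    on the head of the argument list, the only entry [Oracle] reads. *)
Fixpoint oracle_subst (c0 c : code) : code :=
  match c with
  | Oracle => Comp c0 [:: Proj 0]
  | Comp f gs => Comp (oracle_subst c0 f) (map (oracle_subst c0) gs)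
  | Rec f g => Rec (oracle_subst c0 f) (oracle_subst c0 g)
  | Mu f => Mu (oracle_subst c0 f)
  | _ => c
  end.

Lemma eval_oracle_subst (p r : baire) c0 :
  (forall n, eval p c0 [:: n] (r n)) ->
  forall c v n, eval r c v n -> eval p (oracle_subst c0 c) v n.
Proof.
move=> c0P c v n ev.
apply: (eval_mut (P := fun c v n => eval p (oracle_subst c0 c) v n)
  (P0 := fun gs v ws => evals p (map (oracle_subst c0) gs) v ws)) ev => /=;
  try by econstructor; eauto.
- move=> m v'; apply: eval_comp (c0P m).
  exact: evals_cons (eval_proj p 0 (m :: v')) (evals_nil _ _).
Qed.

Section Computed.
Variables (I : Type) (o : I -> baire) (a : I -> seq nat).

(** One program serves every index. An index packs an oracle with argument values, so computability
    proofs become combinators over families. *)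
Definition computed (F : I -> nat) : Prop :=
  exists c, forall i, eval (o i) c (a i) (F i).

Definition computeds (L : I -> seq nat) : Prop :=
  exists cs, forall i, evals (o i) cs (a i) (L i).

Lemma computed_ext F G : F =1 G -> computed F -> computed G.
Proof. by move=> FG [c cP]; exists c => i; rewrite -FG. Qed.

Lemma computeds_nil : computeds (fun=> [::]).
Proof. by exists [::] => i; constructor. Qed.

Lemma computeds_cons F L :
  computed F -> computeds L -> computeds (fun i => F i :: L i).
Proof. by move=> [c cP] [cs csP]; exists (c :: cs) => i; constructor. Qed.

Lemma computed_proj k F : (forall i, nth 0 (a i) k = F i) -> computed F.
Proof. by move=> aF; exists (Proj k) => i; rewrite -aF; constructor. Qed.

Lemma computeds_proj (s : seq nat) :
  computeds (fun i => map (nth 0 (a i)) s).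
Proof.
elim: s => [|k s IHs] /=; first exact: computeds_nil.
by apply: computeds_cons IHs; apply: (computed_proj (k := k)).
Qed.

Lemma computeds_drop k m L : (forall i, size (a i) = k) ->
  (forall i, drop m (a i) = L i) -> computeds L.
Proof.
move=> ak aL; have [cs csP] := computeds_proj (iota m (k - m)).
exists cs => i; have := csP i.
by rewrite map_nth_iota ?ak// aL take_oversize// -aL size_drop ak.
Qed.

Lemma computeds_args k : (forall i, size (a i) = k) -> computeds a.
Proof.
by move=> ak; apply: (computeds_drop (m := 0) ak) => i; rewrite drop0.
Qed.

Lemma computed_const n : computed (fun=> n).
Proof.
elim: n => [|n [c cP]]; first by exists Zero => i; constructor.
exists (Comp Succ [:: c]) => i; apply: eval_comp (eval_succ _ _ [::]).
by constructor => //; constructor.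
Qed.

Lemma computed_succ F : computed F -> computed (fun i => (F i).+1).
Proof.
move=> [c cP]; exists (Comp Succ [:: c]) => i.
by apply: eval_comp (eval_succ _ _ [::]); constructor => //; constructor.
Qed.

Lemma computed_oracle F : computed F -> computed (fun i => o i (F i)).
Proof.
move=> [c cP]; exists (Comp Oracle [:: c]) => i.
by apply: eval_comp (eval_oracle _ _ [::]); constructor => //; constructor.
Qed.

End Computed.

Lemma computed_comp I J (h : J -> I) o a o' a' F :
  (forall j, o' j = o (h j)) ->
  computeds o' a' (fun j => a (h j)) -> @computed I o a F ->
  computed o' a' (fun j => F (h j)).
Proof.
move=> oh [cs csP] [c cP]; exists (Comp c cs) => j.
by apply: eval_comp (csP j) _; rewrite oh.
Qed.

Lemma computed_oracle_subst I (o o' : I -> baire) a F :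
  computed (fun x : I * nat => o x.1) (fun x => [:: x.2])
    (fun x => o' x.1 x.2) ->
  computed o' a F -> computed o a F.
Proof.
move=> [c0 c0P] [c cP]; exists (oracle_subst c0 c) => i.
by apply: eval_oracle_subst (cP i) => n; apply: (c0P (i, n)).
Qed.

(** The step program receives the counter, the previous value and then the old arguments, in the
    order in which [Rec] passes them. The length [k] is uniform so that finitely many projections
    can copy the arguments. *)
Lemma computed_rec k I o a (H F B : I -> nat) (G : I -> nat -> nat -> nat) :
  (forall i, size (a i) = k) ->
  (forall i, nat_rect (fun=> nat) (B i) (G i) (F i) = H i) ->
  computed o a F -> computed o a B ->
  computed (fun x : I * nat * nat => o x.1.1)
    (fun x => [:: x.1.2, x.2 & a x.1.1]) (fun x => G x.1.1 x.1.2 x.2) ->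
  computed o a H.
Proof.
move=> ak GH cF [b bP] [g gP].
have [cs csP] := computeds_cons cF (computeds_args o ak).
exists (Comp (Rec b g) cs) => i; apply: eval_comp (csP i) _; rewrite -GH.
elim: (F i) => [|n IHn] /=; first by constructor; apply: bP.
by apply: eval_recS IHn (gP (i, n, _)).
Qed.

Definition computed_fun1 (f : nat -> nat) : Prop :=
  computed (fun x : baire * nat => x.1) (fun x => [:: x.2]) (fun x => f x.2).

Definition computed_fun2 (f : nat -> nat -> nat) : Prop :=
  computed (fun x : baire * nat * nat => x.1.1) (fun x => [:: x.1.2; x.2])
    (fun x => f x.1.2 x.2).

Section ComputedFun.
Variables (I : Type) (o : I -> baire) (a : I -> seq nat).

Lemma computed_app1 f F :
  computed_fun1 f -> computed o a F -> computed o a (fun i => f (F i)).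
Proof.
move=> cf cF; pose h i := (o i, F i).
apply: (computed_comp (h := h) _ _ cf) => //.
exact: computeds_cons cF (computeds_nil _ _).
Qed.

Lemma computed_app2 f F G : computed_fun2 f -> computed o a F ->
  computed o a G -> computed o a (fun i => f (F i) (G i)).
Proof.
move=> cf cF cG; pose h i := (o i, F i, G i).
apply: (computed_comp (h := h) _ _ cf) => //.
exact: computeds_cons cF (computeds_cons cG (computeds_nil _ _)).
Qed.

End ComputedFun.

(** * Arithmetic and Boolean functions *)

Ltac proj j := by apply: (@computed_proj _ _ _ j).

Lemma computed_fun2_add : computed_fun2 addn.
Proof.
apply: (@computed_rec 2 _ _ _ _ (fun x => x.1.2) (fun x => x.2)
  (fun _ _ m => m.+1)) => //; [|proj 0|proj 1|apply: computed_succ; proj 1].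
by case=> [[p m] n] /=; elim: m => //= m ->.
Qed.
Definition computed_add I o a F G :=
  @computed_app2 I o a addn F G computed_fun2_add.

Lemma computed_fun2_mul : computed_fun2 muln.
Proof.
apply: (@computed_rec 2 _ _ _ _ (fun x => x.1.2) (fun x => 0)
  (fun x _ m => x.2 + m)) => //; [|proj 0|exact: computed_const|].
  by case=> [[p m] n] /=; elim: m => //= m ->.
apply: computed_add; [proj 3|proj 1].
Qed.
Definition computed_mul I o a F G :=
  @computed_app2 I o a muln F G computed_fun2_mul.

Lemma computed_fun2_expn : computed_fun2 expn.
Proof.
apply: (@computed_rec 2 _ _ _ _ (fun x => x.2) (fun x => 1)
  (fun x _ m => x.1.2 * m)) => //; [|proj 1|exact: computed_const|].
  by case=> [[p m] n] /=; elim: n => //= n ->; rewrite expnS.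
apply: computed_mul; [proj 2|proj 1].
Qed.
Definition computed_expn I o a F G :=
  @computed_app2 I o a expn F G computed_fun2_expn.

Lemma computed_fun1_pred : computed_fun1 predn.
Proof.
apply: (@computed_rec 1 _ _ _ _ (fun x => x.2) (fun x => 0)
  (fun x n _ => n)) => //; [|proj 0|exact: computed_const|proj 0].
by case=> [p []].
Qed.
Definition computed_pred I o a F :=
  @computed_app1 I o a predn F computed_fun1_pred.

Lemma computed_fun2_sub : computed_fun2 subn.
Proof.
apply: (@computed_rec 2 _ _ _ _ (fun x => x.2) (fun x => x.1.2)
  (fun x _ m => m.-1)) => //; [|proj 1|proj 0|apply: computed_pred; proj 1].
by case=> [[p m] n] /=; elim: n => [|n /= ->]; rewrite ?subn0// subnS.
Qed.
Definition computed_sub I o a F G :=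
  @computed_app2 I o a subn F G computed_fun2_sub.

Section Booleans.
Variables (I : Type) (o : I -> baire) (a : I -> seq nat).
Implicit Types (F G : I -> nat) (b : I -> bool).

Lemma computed_leq F G : computed o a F -> computed o a G ->
  computed o a (fun i => (F i <= G i)).
Proof.
move=> cF cG; apply: (computed_ext (F := fun i => 1 - (F i - G i))) => [i|].
  by rewrite /leq; case: (F i - G i) => //= n; rewrite subSS.
exact: computed_sub (computed_const _ _ _) (computed_sub cF cG).
Qed.

Lemma computed_eq F G : computed o a F -> computed o a G ->
  computed o a (fun i => (F i == G i)).
Proof.
move=> cF cG.
apply: (computed_ext (F := fun i => (F i <= G i) * (G i <= F i))) => [i|].
  by rewrite mulnb -eqn_leq.
by apply: computed_mul; apply: computed_leq.
Qed.

Lemma computed_neg b : computed o a b -> computed o a (fun i => ~~ b i).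
Proof.
move=> cb; apply: (computed_ext (F := fun i => 1 - b i)) => [i|].
  by case: (b i).
exact: computed_sub (computed_const _ _ _) cb.
Qed.

Lemma computed_and b b' : computed o a b -> computed o a b' ->
  computed o a (fun i => b i && b' i).
Proof.
move=> cb cb'; apply: (computed_ext (F := fun i => b i * b' i)) => [i|].
  by rewrite mulnb.
exact: computed_mul.
Qed.

Lemma computed_or b b' : computed o a b -> computed o a b' ->
  computed o a (fun i => b i || b' i).
Proof.
move=> cb cb'.
apply: (computed_ext (F := fun i => ~~ (~~ b i && ~~ b' i))) => [i|].
  by rewrite negb_and !negbK.
by apply: computed_neg; apply: computed_and; apply: computed_neg.
Qed.

Lemma computed_sum k F (G : I -> nat -> nat) :
  (forall i, size (a i) = k) -> computed o a F ->
  computed (fun x : I * nat => o x.1) (fun x => x.2 :: a x.1)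
    (fun x => G x.1 x.2) ->
  computed o a (fun i => \sum_(j < F i) G i j).
Proof.
move=> ak cF cG.
apply: (computed_rec (F := F) (B := fun=> 0) (G := fun i j s => s + G i j) ak)
  => //; last 2 first.
- exact: computed_const.
- apply: computed_add; first proj 1.
  pose h (x : I * nat * nat) := (x.1.1, x.1.2).
  apply: (computed_comp (h := h) _ _ cG) => //.
  apply: computeds_cons; first proj 0.
  by apply: (@computeds_drop _ _ _ k.+2 2) => x /=; rewrite ?ak ?drop0.
- by move=> i; elim: (F i) => [|n IHn]; rewrite ?big_ord0// big_ord_recr -IHn.
Qed.

End Booleans.

Lemma sum_nat_lt n m : m <= n -> \sum_(i < n) (i < m : nat) = m.
Proof.
move=> lemn; rewrite -[RHS]card_ord -sum1_card.
rewrite (big_ord_widen_cond n predT (fun=> 1))// [RHS]big_mkcond.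
by apply: eq_bigr => i _; case: (i < m).
Qed.

(** The quotient counts the positive multiples of [d.+1] up to [m], which makes it a bounded sum of
    truth values. *)
Lemma computed_fun2_div : computed_fun2 (fun m d => m %/ d.+1).
Proof.
apply: (computed_ext (F := fun x : baire * nat * nat =>
  \sum_(i < x.1.2) (i.+1 * x.2.+1 <= x.1.2))) => [[[p m] d]/=|].
  rewrite -[RHS](@sum_nat_lt m); last exact: leq_div.
  by apply: eq_bigr => i _; rewrite -leq_divRL.
apply: (@computed_sum _ _ _ 2 _ (fun x i => (i.+1 * x.2.+1 <= x.1.2))) => //.
  proj 0.
by apply: computed_leq; [apply: computed_mul; apply: computed_succ|];
  [proj 0|proj 2|proj 1].
Qed.

Lemma computed_div I o a F G : (forall i, 0 < G i) -> computed o a F ->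
  computed o a G -> @computed I o a (fun i => F i %/ G i).
Proof.
move=> G0 cF cG.
have := computed_app2 computed_fun2_div cF (computed_pred cG).
by apply: computed_ext => i; rewrite prednK.
Qed.

Lemma computed_fun1_fact : computed_fun1 factorial.
Proof.
apply: (@computed_rec 1 _ _ _ _ (fun x => x.2) (fun x => 1)
  (fun x n m => n.+1 * m)) => //; first by case=> p; elim=> //= n ->.
- proj 0.
- exact: computed_const.
- apply: computed_mul; [apply: computed_succ; proj 0|proj 1].
Qed.
Definition computed_fact I o a F :=
  @computed_app1 I o a factorial F computed_fun1_fact.

(** * Arithmetic of sequence codes *)

Definition item (e i : nat) : nat := nth 0 (CodeSeq.decode e) i.

(** The code of [n :: s] is [2 ^ n * (2 * c + 1)] with [c] the code of [s]. The head is thus the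
    2-adic valuation, found by counting the powers of 2 that divide [e]. *)
Definition code_head e := \sum_(i < e) (2 ^ i.+1 * (e %/ 2 ^ i.+1) == e : nat).
Definition code_tail e := e %/ 2 ^ code_head e %/ 2.

Lemma code_head_cons n s : code_head (CodeSeq.code (n :: s)) = n.
Proof.
rewrite /code_head /=; set e := _ * _.
have ltne : n < e.
  by apply: leq_trans (ltn_expl n (ltnSn 1)) _; apply: leq_pmulr.
rewrite -[RHS](@sum_nat_lt e); last exact: ltnW.
apply: eq_bigr => i _; congr nat_of_bool.
rewrite mulnC -dvdn_eq /e Gauss_dvdl; first by rewrite dvdn_Pexp2l.
by rewrite coprimeXl// coprime2n /= odd_double.
Qed.

Lemma code_tail_cons n s :
  code_tail (CodeSeq.code (n :: s)) = CodeSeq.code s.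
Proof.
rewrite /code_tail code_head_cons /= mulKn ?expn_gt0//.
by rewrite divn2 /= uphalf_double.
Qed.

(** The code 0 of the empty list is fixed by [code_tail] and has head 0, which matches the default
    value of [nth] past the end. *)
Lemma itemE e i : item e i = code_head (iter i code_tail e).
Proof.
have tail0 : code_tail 0 = 0 by rewrite /code_tail !div0n.
have it0 j : iter j code_tail 0 = 0 by elim: j => //= j ->.
rewrite -[in RHS](CodeSeq.decodeK e) /item.
elim: (CodeSeq.decode e) i => [|n s IHs] i.
  by rewrite nth_nil -[CodeSeq.code [::]]/0 it0 /code_head big_ord0.
case: i => [|i]; first by rewrite -[iter 0 _ _]/(CodeSeq.code _) code_head_cons.
by rewrite iterSr code_tail_cons -IHs.
Qed.

Lemma computed_fun1_head : computed_fun1 code_head.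
Proof.
apply: (@computed_sum _ _ _ 1 _
  (fun x i => (2 ^ i.+1 * (x.2 %/ 2 ^ i.+1) == x.2))) => //; first proj 0.
apply: computed_eq; last proj 1.
have c2 (J := (baire * nat * nat)%type) : @computed J (fun x => x.1.1)
    (fun x => [:: x.2; x.1.2]) (fun x => 2 ^ x.2.+1).
  by apply: computed_expn; [exact: computed_const|apply: computed_succ; proj 0].
apply: computed_mul => //; apply: computed_div => //; last proj 1.
by move=> i; rewrite expn_gt0.
Qed.

Lemma computed_fun1_tail : computed_fun1 code_tail.
Proof.
apply: computed_div => //; last exact: computed_const.
apply: computed_div => [i||]; [by rewrite expn_gt0|proj 0|].
apply: computed_expn; first exact: computed_const.
exact: computed_fun1_head.
Qed.

Lemma computed_fun2_item : computed_fun2 item.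
Proof.
apply: (computed_ext (F := fun x : baire * nat * nat =>
    code_head (iter x.2 code_tail x.1.2))) => [x|]; first by rewrite itemE.
apply: computed_app1; first exact: computed_fun1_head.
apply: (@computed_rec 2 _ _ _ _ (fun x => x.2) (fun x => x.1.2)
  (fun x _ m => code_tail m)) => //; [proj 1|proj 0|].
by apply: computed_app1; [exact: computed_fun1_tail|proj 1].
Qed.
Definition computed_item I o a F G :=
  @computed_app2 I o a item F G computed_fun2_item.

(** * Joined oracles and transitivity of Weihrauch reducibility *)

Definition joined I (p q : I -> baire) (i : I) : baire := join (p i) (q i).

Lemma computed_join_l I (p q : I -> baire) a F : computed (joined p q) a F ->
  computed (joined p q) a (fun i => p i (F i)).
Proof.
move=> cF; have := computed_oracle (computed_add cF cF).
apply: computed_ext => i.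
by rewrite /joined /join addnn odd_double doubleK.
Qed.

Lemma computed_join_r I (p q : I -> baire) a F : computed (joined p q) a F ->
  computed (joined p q) a (fun i => q i (F i)).
Proof.
move=> cF; have := computed_oracle (computed_succ (computed_add cF cF)).
apply: computed_ext => i.
by rewrite /joined /join addnn /= odd_double /= uphalf_double.
Qed.

Lemma computed_odd I o a F : @computed I o a F ->
  computed o a (fun i => odd (F i)).
Proof.
move=> cF; pose E i := ~~ (F i %/ 2 * 2 == F i).
apply: (@computed_ext _ _ _ E) => [i|].
  by rewrite /E -dvdn_eq dvdn2 negbK.
apply: computed_neg; apply: computed_eq => //; apply: computed_mul;
  last exact: computed_const.
by apply: computed_div => //; exact: computed_const.
Qed.

(** A query to the join is answered according to the parity of its position, by one of the two
    components that [o] computes. *)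
Lemma computed_joined I (o p q : I -> baire) a F :
  computed (fun x : I * nat => o x.1) (fun x => [:: x.2])
    (fun x => p x.1 x.2) ->
  computed (fun x : I * nat => o x.1) (fun x => [:: x.2])
    (fun x => q x.1 x.2) ->
  computed (joined p q) a F -> computed o a F.
Proof.
move=> cp cq; apply: computed_oracle_subst.
have cn : computed (fun x : I * nat => o x.1) (fun x => [:: x.2])
  (fun x => x.2) by proj 0.
have half r : computed (fun x : I * nat => o x.1) (fun x => [:: x.2])
    (fun x => r x.1 x.2) ->
  computed (fun x : I * nat => o x.1) (fun x => [:: x.2])
    (fun x => r x.1 (x.2 %/ 2)).
  move=> cr; apply: (computed_comp (h := fun x => (x.1, x.2 %/ 2)) _ _ cr) => //.
  apply: computeds_cons (computeds_nil _ _).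
  by apply: computed_div => //; exact: computed_const.
apply: (computed_ext (F := fun x : I * nat =>
    odd x.2 * q x.1 (x.2 %/ 2) + ~~ odd x.2 * p x.1 (x.2 %/ 2))) => [[i n]/=|].
  by rewrite /joined /join divn2; case: (odd n); rewrite /= mul1n mul0n ?addn0.
apply: computed_add; apply: computed_mul; try exact: half.
  exact: computed_odd.
by apply: computed_neg; apply: computed_odd.
Qed.

Lemma weihrauch_le_trans X Y Z W S T (f : multifun X Y) (g : multifun Z W)
    (h : multifun S T) :
  weihrauch_le f g -> weihrauch_le g h -> weihrauch_le f h.
Proof.
move=> [H1 [K1 [cH1 cK1 fg]]] [H2 [K2 [cH2 cK2 gh]]].
exists (fun p => obind H2 (H1 p)).
exists (fun p r => obind (fun u => obind (K1 p) (K2 u r)) (H1 p)).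
split; last first.
- move=> G /gh/fg fr p x px fx; have [r [y [Fp ry fxy]]] := fr p x px fx.
  exists r, y; split=> //; move: Fp; case: (H1 p) => //= u.
  by case: (H2 u) => //= s; case: (G s).
(* An index records a complete run of the composite: [u] from [H1], [s] from [K2], [t] from [K1]. On
   such runs the partial functions are total, so the [computed] combinators apply. *)
- pose J := {x : baire * baire * baire * baire * baire |
    let: (p, r, u, s, t) := x in
    [/\ H1 p = Some u, K2 u r = Some s & K1 p s = Some t]}.
  pose jp (j : J) := let: (p, r, u, s, t) := sval j in p.
  pose jr (j : J) := let: (p, r, u, s, t) := sval j in r.
  pose ju (j : J) := let: (p, r, u, s, t) := sval j in u.
  pose js (j : J) := let: (p, r, u, s, t) := sval j in s.
  pose jt (j : J) := let: (p, r, u, s, t) := sval j in t.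
  have c1 : computed (joined jp js \o fst) (fun x => [:: x.2])
      (fun x : J * nat => jt x.1 x.2).
    have [c cP] := cK1; exists c => -[[[[[[p r] u] s] t] [/= Eu Es Et]] n].
    exact: cP Et n.
  have c2 : computed (joined ju jr \o fst) (fun x => [:: x.2])
      (fun x : J * nat => js x.1 x.2).
    have [c cP] := cK2; exists c => -[[[[[[p r] u] s] t] [/= Eu Es Et]] n].
    exact: cP Es n.
  have c3 : computed (jp \o fst) (fun x => [:: x.2])
      (fun x : J * nat => ju x.1 x.2).
    have [c cP] := cH1; exists c => -[[[[[[p r] u] s] t] [/= Eu Es Et]] n].
    exact: cP Eu n.
  have cp : computed (joined jp jr \o fst) (fun x => [:: x.2])
      (fun x : J * nat => jp x.1 x.2).
    by apply: (@computed_join_l _ (jp \o fst) (jr \o fst)); proj 0.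
  have cr : computed (joined jp jr \o fst) (fun x => [:: x.2])
      (fun x : J * nat => jr x.1 x.2).
    by apply: (@computed_join_r _ (jp \o fst) (jr \o fst)); proj 0.
  have lift (o : J -> baire) (F : J -> baire) :
      computed (o \o fst) (fun x => [:: x.2]) (fun x : J * nat => F x.1 x.2) ->
    computed (fun x : J * nat * nat => o x.1.1) (fun x => [:: x.2])
      (fun x => F x.1.1 x.2).
    move=> cF.
    apply: (computed_comp (h := fun x => (x.1.1, x.2)) _ _ cF) => //.
    by apply: computeds_cons (computeds_nil _ _); proj 0.
  pose o := joined jp jr \o (@fst J nat).
  have cu := @computed_oracle_subst _ o _ _ _ (lift _ _ cp) c3.
  have cs := @computed_joined _ o (ju \o fst) (jr \o fst) _ _
    (lift _ _ cu) (lift _ _ cr) c2.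
  have [c cP] := @computed_joined _ o (jp \o fst) (js \o fst) _ _
    (lift _ _ cp) (lift _ _ cs) c1.
  exists c => p r t; case Eu: (H1 p) => [u|]//=; case Es: (K2 u r) => [s|]//= Et.
  move=> n; pose j : J := exist _ (p, r, u, s, t) (And3 Eu Es Et).
  exact: (cP (j, n)).
- have [c1 c1P] := cH1; have [c2 c2P] := cH2.
  exists (oracle_subst c1 c2) => p r; case Eu: (H1 p) => [u|]//= Er n.
  by apply: eval_oracle_subst (c2P _ _ Er n) => m; apply: c1P.
Qed.

(** * Fourier coefficients on the unit circle *)

Section Fourier.
Local Open Scope ring_scope.
Variable C : numClosedFieldType.

(** In characteristic 0 the polynomial ['X^N - 1] is separable; its [N] distinct roots form a finite
    subgroup of a field, which is cyclic. *)
Lemma prim_root_exists N : (0 < N)%N -> exists w : C, N.-primitive_root w.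
Proof.
move=> N0; have [r Er] := closed_field_poly_normal ('X^N - 1 : {poly C}).
have {}Er : \prod_(z <- r) ('X - z%:P) = 'X^N - 1 :> {poly C}.
  by rewrite [RHS]Er (monicP (monicXnsubC _ N0)) scale1r.
suff /hasP[w _ ?] : has N.-primitive_root r by exists w.
apply: has_prim_root => //.
- by apply/allP => z; rewrite -root_prod_XsubC Er.
- by rewrite -separable_prod_XsubC Er separable_Xn_sub_1// pnatr_eq0 -lt0n.
- by rewrite -ltnS -(size_prod_XsubC r id) Er size_XnsubC.
Qed.

Section PrimitiveRoot.
Variables (N : nat) (w : C).
Hypothesis w_prim : N.-primitive_root w.

Lemma norm_prim_root : `|w| = 1.
Proof.
apply/eqP; rewrite -(@pexpr_eq1 _ _ N)//; last exact: prim_order_gt0 w_prim.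
by rewrite -normrX prim_expr_order ?normr1.
Qed.

Lemma norm_prim_rootX m : `|w ^+ m| = 1.
Proof. by rewrite normrX norm_prim_root expr1n. Qed.

(** Orthogonality of characters. Conjugation inverts on the unit circle, so this is a geometric sum
    with ratio [x = w ^+ a / w ^+ b]; as [x ^+ N = 1], it vanishes unless [x = 1]. *)
Lemma sum_prim_root (a b : nat) : (a < N)%N -> (b < N)%N ->
  \sum_(m < N) (w ^+ m) ^+ a * (w ^+ m)^* ^+ b = N%:R *+ (a == b).
Proof.
move=> aN bN; have wV m : (w ^+ m)^* = (w ^+ m)^-1.
  by rewrite invC_norm norm_prim_rootX expr1n invr1 mul1r.
pose x := w ^+ a / w ^+ b.
have wb0 : w ^+ b != 0 by rewrite -normr_eq0 norm_prim_rootX oner_eq0.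
have -> : \sum_(m < N) (w ^+ m) ^+ a * (w ^+ m)^* ^+ b = \sum_(m < N) x ^+ m.
  apply: eq_bigr => m _; rewrite wV expr_div_n exprVn.
  by rewrite -!exprM [(a * m)%N]mulnC [(b * m)%N]mulnC.
have x1 : (x == 1) = (a == b).
  rewrite -(inj_eq (mulIf wb0)) mul1r divfK// (eq_prim_root_expr w_prim).
  by rewrite !modn_small.
rewrite -x1; have [->|xn1] := eqVneq x 1.
  rewrite (eq_bigr (fun=> 1)) ?sumr_const ?card_ord// => m _.
  by rewrite expr1n.
have := subrX1 x N.
have -> : x ^+ N = 1.
  by rewrite expr_div_n -!exprM ![(_ * N)%N]mulnC !exprM !(prim_expr_order w_prim)
    !expr1n divr1.
by move/esym/eqP; rewrite subrr mulf_eq0 subr_eq0 (negPf xn1) => /eqP->.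
Qed.

End PrimitiveRoot.

(* Averaging over the N-th roots of unity, with N above all exponents, extracts
   the k-th Fourier coefficient on the unit circle. *)
Lemma coef_le_circle (P : {poly C}) (I : eqType)
    (s : seq I) (c : I -> C) (j l : I -> nat) (k : nat) (eps : C) :
  (forall z, `|z| = 1 ->
     `|P.[z] - \sum_(i <- s) c i * z ^+ j i * z^* ^+ l i| <= eps)%R ->
  (`|P`_k - \sum_(i <- s | j i == (l i + k)%N) c i| <= eps)%R.
Proof.
(* [N] exceeds every degree in [P], every [j i] and every [l i + k], so that distinct exponents stay
   distinct modulo [N]. *)
move=> Peps; pose N := (size P + k + \sum_(i <- s) (j i + l i)).+1.
have [w w_prim] := prim_root_exists (ltn0Sn _ : (0 < N)%N).
pose avg g : C := \sum_(m < N) g (w ^+ m) * (w ^+ m)^* ^+ k.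
have kN : (k < N)%N by rewrite /N; lia.
have avgP : avg (horner P) = N%:R * P`_k.
  rewrite /avg; under eq_bigr => m _.
    rewrite (@horner_coef_wide _ N); last by rewrite /N; lia.
    rewrite mulr_suml; under eq_bigr do rewrite -mulrA; over.
  rewrite exchange_big /=; under eq_bigr => i _.
    rewrite -mulr_sumr (sum_prim_root w_prim)//; over.
  rewrite (bigD1 (Ordinal kN))//= eqxx mulr1n big1 ?addr0 1?mulrC// => i.
  by rewrite -val_eqE /= => /negPf->; rewrite mulr0.
have avgs : avg (fun z => \sum_(i <- s) c i * z ^+ j i * z^* ^+ l i) =
    N%:R * \sum_(i <- s | j i == (l i + k)%N) c i.
  rewrite /avg; under eq_bigr => m _.
    rewrite mulr_suml; under eq_bigr do rewrite -!mulrA -exprD; over.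
  rewrite exchange_big /= mulr_sumr [RHS]big_mkcond big_seq [RHS]big_seq.
  apply: eq_bigr => i si; rewrite -mulr_sumr.
  have lt : (j i + l i <= \sum_(i <- s) (j i + l i))%N.
    by rewrite (big_rem i)//= leq_addr.
  rewrite (sum_prim_root w_prim); try by rewrite /N; lia.
  by case: ifP => _; rewrite ?mulr1n ?mulr0n ?mulr0// mulrC.
(* After scaling by [N], the difference is a sum of [N] errors on the circle with weights of modulus
   1, each at most [eps]. *)
have N0 : 0 < N%:R :> C by rewrite ltr0n.
rewrite -(ler_pM2l N0) -{1}(normr_nat C N) -normrM mulrBr.
rewrite -avgP -avgs -sumrB.
under eq_bigr do rewrite -mulrBl.
rewrite (le_trans (ler_norm_sum _ _ _))//.
rewrite -[N in leRHS]card_ord -sum1_card natr_sum mulr_suml.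
apply: ler_sum => m _; rewrite normrM normrX norm_conjC.
rewrite (norm_prim_rootX w_prim) expr1n mulr1 mul1r Peps//.
exact: norm_prim_rootX w_prim _.
Qed.

End Fourier.

(** * Testing coefficients by integer arithmetic *)

Section Coefficients.
Variable R : realType.
Local Open Scope ring_scope.
Local Open Scope complex_scope.

(** Prepending an entry strictly increases the code. This lets [coef_num] sum over all [j < e]. *)
Lemma size_decode e : (size (CodeSeq.decode e) <= e)%N.
Proof.
rewrite -[leqRHS]CodeSeq.decodeK; elim: (CodeSeq.decode e) => //= n s IHs.
apply: leq_trans (leq_pmull _ _); last by rewrite expn_gt0.
by rewrite ltnS (leq_trans IHs)// -addnn leq_addr.
Qed.

Lemma item_default e i : (size (CodeSeq.decode e) <= i)%N -> item e i = 0%N.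
Proof. exact: nth_default. Qed.

Lemma item_lt e i : (0 < e)%N -> (item e i < e)%N.
Proof.
move=> e0; have [lt|ge] := ltnP i (size (CodeSeq.decode e)).
  by have /allP := CodeSeq.gtn_decode e; apply; apply: mem_nth.
by rewrite item_default.
Qed.

Lemma item_le e i : (item e i <= e)%N.
Proof. by case: e => [|e]; [case: i|apply/ltnW/item_lt]. Qed.

Definition monomial_coef (n : nat) : R[i] :=
  (((item n 0)%:R - (item n 1)%:R) +i* ((item n 2)%:R - (item n 3)%:R))
    / (item n 4).+1%:R.

(* On the unit circle [z^j * conj(z)^l] is [z^(j - l)], so this is the [k]-th
   Fourier coefficient of [rat_poly e] there. *)
Definition fourier_coef (e k : nat) : R[i] :=
  \sum_(n <- CodeSeq.decode e | item n 5 == (item n 6 + k)%N) monomial_coef n.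

(** The factorial of [e] is a common denominator, because every denominator that occurs is at most
    [e]. Entries 0 to 3 give the positive and negative contributions to the real and imaginary
    parts. *)
Definition coef_num (i e k : nat) : nat :=
  (\sum_(j < e) (item (item e j) 5 == item (item e j) 6 + k) *
     (item (item e j) i * (e`! %/ (item (item e j) 4).+1)))%N.

(** Subtraction is truncated, so [d i j] is the distance of two numerators. The value is the squared
    modulus of [fourier_coef e k] times the squared common denominator. *)
Definition coef_sqnum (e k : nat) : nat :=
  let d i j := ((coef_num i e k - coef_num j e k) +
                (coef_num j e k - coef_num i e k))%N in
  (d 0%N 1%N * d 0%N 1%N + d 2%N 3%N * d 2%N 3%N)%N.

Definition coef_test (e k t : nat) : bool :=
  (e`! * e`! < coef_sqnum e k * 4 ^ t)%N.

Lemma complex_divn (x y : R) (n : nat) :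
  (x +i* y) / n%:R = (x / n%:R) +i* (y / n%:R) :> R[i].
Proof.
have [->|n0] := eqVneq n 0%N.
  by rewrite !invr0 !mulr0.
have nC : (n%:R : R[i]) != 0 by rewrite pnatr_eq0.
apply: (mulIf nC); rewrite divfK//.
have -> : (n%:R : R[i]) = (n%:R : R)%:C by rewrite rmorph_nat.
by simpc; rewrite !divfK ?pnatr_eq0// !mulr0 subr0 add0r.
Qed.

Lemma sum_complex (I : Type) (s : seq I) (p : pred I) (x y : I -> R) :
  \sum_(i <- s | p i) (x i +i* y i) =
  (\sum_(i <- s | p i) x i) +i* (\sum_(i <- s | p i) y i) :> R[i].
Proof. by elim/big_rec3: _ => // i a b c _ ->; simpc. Qed.

Lemma fourier_coefE e k : fourier_coef e k =
  (((coef_num 0 e k)%:R - (coef_num 1 e k)%:R) / e`!%:R) +i*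
  (((coef_num 2 e k)%:R - (coef_num 3 e k)%:R) / e`!%:R).
Proof.
have num i : (coef_num i e k)%:R / e`!%:R =
    \sum_(n <- CodeSeq.decode e | item n 5 == (item n 6 + k)%N)
      (item n i)%:R / (item n 4).+1%:R :> R.
  rewrite (big_nth 0%N) big_mkord big_mkcond /=.
  rewrite (big_ord_widen e (fun j => if item (item e j) 5 ==
    (item (item e j) 6 + k)%N then (item (item e j) i)%:R /
      (item (item e j) 4).+1%:R else 0)) ?size_decode// big_mkcond /=.
  rewrite /coef_num natr_sum mulr_suml; apply: eq_bigr => j _.
  (* Past the end of the list [item e j] is 0, the code of the empty list, whose entries are all
     0. *)
  have i0 m : item 0 m = 0%N by case: m.
  case: ltnP => [_|le]; last first.
    by rewrite (item_default le) !i0 mul0n muln0 mul0r.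
  case: ifP; rewrite ?mul0n ?mul0r// mul1n => _.
  have dv : ((item (item e j) 4).+1 %| e`!)%N.
    apply: dvdn_fact; rewrite /= (leq_ltn_trans (item_le _ _))// item_lt//.
    exact: leq_ltn_trans (ltn_ord j).
  rewrite -[in X in _ / X = _](divnK dv) !natrM invfM mulrA mulfK//.
  by rewrite pnatr_eq0 -lt0n divn_gt0// dvdn_leq// fact_gt0.
rewrite !mulrBl !num -!sumrB -sum_complex; apply: eq_bigr => n _.
by rewrite /monomial_coef complex_divn !mulrBl.
Qed.

Lemma sqr_dist (m n : nat) :
  ((m - n + (n - m)) * (m - n + (n - m)))%:R = (m%:R - n%:R) ^+ 2 :> R.
Proof.
rewrite natrM -expr2; case: (leqP m n) => [le|/ltnW le].
  by rewrite (eqP le) add0n natrB// -[RHS]sqrrN opprB.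
by rewrite [(n - m)%N](eqP le) addn0 natrB.
Qed.

Lemma coef_testE e k t :
  coef_test e k t = (2^-1 ^+ t < normc (fourier_coef e k)).
Proof.
have D0 : 0 < e`!%:R :> R by rewrite ltr0n fact_gt0.
have -> : (2^-1 ^+ t < normc (fourier_coef e k)) =
    ((2^-1 ^+ t) ^+ 2 < normc (fourier_coef e k) ^+ 2).
  by rewrite ltr_sqr// nnegrE ?exprn_ge0// fourier_coefE sqrtr_ge0.
have -> : (2^-1 ^+ t) ^+ 2 = (4 ^+ t)^-1 :> R.
  by rewrite -exprM mulnC exprM exprVn exprVn -natrX.
rewrite fourier_coefE /= sqr_sqrtr ?addr_ge0 ?sqr_ge0//.
rewrite /coef_test -(ltr_nat R) !natrM /coef_sqnum natrD !sqr_dist natrX.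
rewrite !expr_div_n -mulrDl ltr_pdivlMr ?exprn_gt0//.
by rewrite ltr_pdivrMl ?exprn_gt0// -!expr2 [X in _ = (_ < X)]mulrC.
Qed.

Lemma normc_norm (z : R[i]) : (normc z)%:C = `|z|.
Proof. by rewrite normc_def; case: z. Qed.

Lemma lec_normc (z : R[i]) (x : R) : (`|z| <= x%:C) = (normc z <= x).
Proof. by rewrite -normc_norm lecR. Qed.

Lemma unit_circle_disk (z : R[i]) : `|z| = 1 -> closed_disk z.
Proof. by rewrite /closed_disk /= => ->. Qed.

Lemma fourier_coef_near (f : @closed_disk R -> R[i]) (P : {poly R[i]}) e k
    (eps : R) :
  (forall z, f z = P.[val z]) -> (sup_dist f (rat_poly e) <= eps%:E)%E ->
  normc (P`_k - fourier_coef e k) <= eps.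
Proof.
move=> fP /ereal_supP fe; rewrite -lec_normc.
apply: coef_le_circle => z z1.
have zD : z \in @closed_disk R by rewrite inE; exact: unit_circle_disk.
rewrite lec_normc -lee_fin; apply: fe.
exists (exist _ z zD) => //=; rewrite fP; congr (normc (_ - _))%:E.
Qed.

(** With the empty sum and error 0, [coef_le_circle] bounds every coefficient of [P - Q] by 0. *)
Lemma poly_restr_inj (f : analyticD R) (P Q : {poly R[i]}) :
  poly_restr f P -> poly_restr f Q -> P = Q.
Proof.
move=> fP fQ; apply/eqP; rewrite -subr_eq0; apply/eqP/polyP => k.
apply/eqP; rewrite coef0 -normr_le0.
have := @coef_le_circle _ (P - Q) nat [::] (fun=> 0) id id k 0.
rewrite big_nil subr0; apply=> z z1; rewrite big_nil subr0 hornerD hornerN.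
have zD : z \in @closed_disk R by rewrite inE; exact: unit_circle_disk.
by have := fP (exist _ z zD); rewrite fQ /= => ->; rewrite subrr normr0.
Qed.

Lemma normc_ge0 (z : R[i]) : 0 <= normc z.
Proof. by case: z => a b; apply: sqrtr_ge0. Qed.

Lemma normcB (z w : R[i]) : normc z - normc w <= normc (z - w).
Proof. by rewrite lerBlDr; have := le_normcD (z - w) w; rewrite subrK. Qed.

Section Test.
Variables (f : @closed_disk R -> R[i]) (P : {poly R[i]}) (p : baire).
Hypotheses (fP : forall z, f z = P.[val z]) (pf : cont_names p f).

Let near k t : normc (P`_k - fourier_coef (p t) k) <= 2^-1 ^+ t.
Proof. by apply: fourier_coef_near fP _; exact/ltW/pf. Qed.

(** If the coefficient were 0, its approximation would have modulus at most [2^-t] and fail the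
    test. *)
Lemma coef_test_sound k t : coef_test (p t) k t -> P`_k != 0.
Proof.
rewrite coef_testE; apply: contraTneq => Pk0; rewrite -leNgt.
by have := near k t; rewrite Pk0 sub0r normcN.
Qed.

Lemma coef_test_complete k : P`_k != 0 -> exists t, coef_test (p t) k t.
Proof.
move=> Pk0; have c0 : 0 < normc P`_k.
  rewrite lt_neqAle normc_ge0 andbT eq_sym.
  by apply: contra Pk0 => /eqP/eq0_normc->.
(* This precision makes [2 * 2^-t] less than the modulus of the coefficient; an approximation off by
   at most [2^-t] then still exceeds [2^-t]. *)
pose t := (Num.truncn (2 / normc P`_k)).+1; exists t; rewrite coef_testE.
have lt_t : 2 / normc P`_k < 2 ^+ t.
  by rewrite (lt_le_trans (truncnS_gt _))// -natrX ler_nat ltnW// ltn_expl.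
have : 2 * 2^-1 ^+ t < normc P`_k.
  by rewrite exprVn ltr_pdivrMr ?exprn_gt0// mulrC -ltr_pdivrMr.
have := near k t; have := normcB P`_k (fourier_coef (p t) k).
by lra.
Qed.

End Test.

End Coefficients.

(** * The degree from choice *)

Section DegreeToChoice.
Local Open Scope nat_scope.

Lemma computed_fun2_coef_num i : computed_fun2 (coef_num i).
Proof.
apply: (@computed_sum _ _ _ 2 _ (fun x j =>
  (item (item x.1.2 j) 5 == item (item x.1.2 j) 6 + x.2) *
    (item (item x.1.2 j) i * (x.1.2`! %/ (item (item x.1.2 j) 4).+1)))) => //.
  proj 0.
have cj : computed (fun x : baire * nat * nat * nat => x.1.1.1)
  (fun x => [:: x.2; x.1.1.2; x.1.2]) (fun x => item x.1.1.2 x.2).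
  by apply: computed_item; [proj 1|proj 0].
have cc n : computed (fun x : baire * nat * nat * nat => x.1.1.1)
    (fun x => [:: x.2; x.1.1.2; x.1.2]) (fun x => item (item x.1.1.2 x.2) n).
  by apply: computed_item => //; exact: computed_const.
apply: computed_mul; [apply: computed_eq|apply: computed_mul] => //.
  by apply: computed_add => //; proj 2.
apply: computed_div => //; last exact: computed_succ.
by apply: computed_fact; proj 1.
Qed.

Lemma computed_fun2_coef_sqnum : computed_fun2 coef_sqnum.
Proof.
have c i := computed_fun2_coef_num i.
apply: computed_add; apply: computed_mul; apply: computed_add;
  apply: computed_sub; exact: c.
Qed.

Lemma computed_coef_test I (o : I -> baire) (a : I -> seq nat) F G H :
  computed o a F -> computed o a G -> computed o a H ->
  computed o a (fun i => coef_test (F i) (G i) (H i)).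
Proof.
move=> cF cG cH; apply: computed_leq.
  by apply: computed_succ; apply: computed_mul; apply: computed_fact.
apply: computed_mul; first exact: computed_app2 computed_fun2_coef_sqnum _ _.
by apply: computed_expn => //; exact: computed_const.
Qed.

(** Approximations start at [q 1], as [q 0] holds the domain and bound. A failing certificate for
    coefficient [n] shows at once; a later nonzero coefficient is found by searching over [k] and
    [t]. *)
Definition degree_refuted (q : baire) (x k t : nat) : bool :=
  let n := item x 0 in let m := item x 1 in
  (0 < n) && ~~ coef_test (q m.+1) n m || (n < k) && coef_test (q t.+1) k t.

(* Enumerates the complement of the set of codes [x] of pairs (n, m) such that
   n = 0 or precision m certifies that the n-th coefficient is nonzero, while
   no precision t certifies that a later coefficient is nonzero. *)
Definition degree_enum (q : baire) (s : nat) : nat :=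
  degree_refuted q (item s 0) (item s 1) (item s 2) * (item s 0).+1.

Lemma computable_degree_enum : computable1 (fun q => Some (degree_enum q)).
Proof.
have [c cP] : computed (fun x : baire * nat => x.1) (fun x => [:: x.2])
    (fun x => degree_enum x.1 x.2).
  have ci n : computed (fun x : baire * nat => x.1) (fun x => [:: x.2])
      (fun x => item x.2 n).
    by apply: computed_item; [proj 0|exact: computed_const].
  have cii n : computed (fun x : baire * nat => x.1) (fun x => [:: x.2])
      (fun x => item (item x.2 0) n).
    by apply: computed_item; [|exact: computed_const].
  apply: computed_mul; last exact: computed_succ.
  apply: computed_or; apply: computed_and.
  - by apply: computed_leq; first exact: computed_const.
  - apply: computed_neg; apply: computed_coef_test => //.
    by apply: computed_oracle; apply: computed_succ.
  - by apply: computed_leq => //; apply: computed_succ.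
  - apply: computed_coef_test => //.
    by apply: computed_oracle; apply: computed_succ.
by exists c => p _ [<-] n; apply: (cP (p, n)).
Qed.

Lemma item_code3 x k t (s := CodeSeq.code [:: x; k; t]) :
  [/\ item s 0 = x, item s 1 = k & item s 2 = t].
Proof. by rewrite /s /item CodeSeq.codeK. Qed.

Definition degree_codes (q : baire) : set nat :=
  ~` [set k | exists2 n, 0 < degree_enum q n & k = degree_enum q n - 1].

Lemma degree_codesP q x :
  degree_codes q x <-> forall k t, ~~ degree_refuted q x k t.
Proof.
split=> [xq k t|ref [s]]; last first.
  rewrite /degree_enum; case: (boolP (degree_refuted _ _ _ _)) => //= + _.
  by rewrite mul1n subn1 /= => + xE; rewrite -xE (negPf (ref _ _)).
apply/negP => xkt; apply: xq; have [s0 s1 s2] := item_code3 x k t.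
exists (CodeSeq.code [:: x; k; t]);
  by rewrite /degree_enum s0 s1 s2 xkt mul1n ?subn1.
Qed.

Variables (R : realType) (f : @closed_disk R -> R[i]) (P : {poly R[i]}).
Variable q : baire.
Hypotheses (fP : forall z, f z = P.[val z]%R).
Hypothesis qf : cont_names (fun n => q n.+1) f.

Lemma degree_codes_nonempty : degree_codes q !=set0.
Proof.
pose n := (size P).-1.
(* For [n = 0] the polynomial may be 0 and have no certificate, hence the implication. *)
have [m mP] : exists m, (0 < n) ==> coef_test (q m.+1) n m.
  have [n0|_] := boolP (0 < n); last by exists 0.
  have [|m mP] := coef_test_complete fP qf (k := n); last by exists m.
  by rewrite -/(lead_coef P) lead_coef_eq0 -size_poly_gt0; apply: contraTT n0;
    rewrite /n; case: (size P).
have [x0 x1 _] := item_code3 n m 0; exists (CodeSeq.code [:: n; m; 0]).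
apply/degree_codesP => k t; rewrite /degree_refuted x0 x1.
rewrite negb_or !negb_and negbK -implybE mP /=.
have [nk|//] := ltnP n k; apply/negP => /(coef_test_sound fP qf).
by rewrite nth_default ?eqxx//; move: nk; rewrite /n; case: (size P).
Qed.

(** By completeness of the test no coefficient beyond [n] is nonzero; by soundness the [n]-th one is
    nonzero if [n > 0]. *)
Lemma degree_codes_degree x : degree_codes q x -> item x 0 = (size P).-1.
Proof.
move/degree_codesP => xq; set n := item x 0.
have le_size : size P <= n.+1.
  apply/leq_sizeP => k nk; apply/eqP; apply: contraT => Pk.
  have [t kt] := coef_test_complete fP qf Pk.
  by have := xq k t; rewrite /degree_refuted nk kt orbT.
have := xq 0 0; rewrite /degree_refuted negb_or !negb_and negbK -implybE.
case/andP => + _ => /implyP; rewrite -/n.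
(* For [n = 0] the size is 0 or 1, and both have predecessor 0. *)
case: (posnP n) => [n0 _|n0 /(_ isT)/(coef_test_sound fP qf) Pn].
  by move: le_size; rewrite n0; case: (size P) => [|[]].
have lt_size : n < size P.
  by rewrite ltnNge; apply: contraNN Pn => ?; rewrite nth_default.
by apply/eqP; rewrite -eqSS prednK ?eqn_leq ?lt_size//; apply: leq_trans lt_size.
Qed.

End DegreeToChoice.

Lemma deg_omega_le_C_nat (R : realType) : weihrauch_le (deg_omega R) C_nat.
Proof.
exists (fun q => Some (degree_enum q)).
exists (fun _ r => Some (fun=> item (r 0%N) 0)); split.
- exact: computable_degree_enum.
- have [c cP] : computed (fun x : baire * baire * nat => join x.1.1 x.1.2)
      (fun x => [:: x.2]) (fun x => item (x.1.2 0%N) 0).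
    apply: computed_item; last exact: computed_const.
    by apply: computed_join_r; exact: computed_const.
  by exists c => p q _ [<-] n; apply: (cP (p, q, n)).
- move=> G GC q f [_ qf] [_ [P fP _]].
  have [r [x [Gr rx Ax]]] := GC (degree_enum q) (degree_codes q) (setCK _)
    (degree_codes_nonempty fP qf).
  exists (fun=> item (r 0%N) 0), (item (r 0%N) 0); split=> //=.
    by rewrite Gr.
  by exists P => //; rewrite rx (degree_codes_degree fP qf).
Qed.

(** * Choice from a degree bound *)

Section ChoiceToBound.
Local Open Scope nat_scope.

(** Bounded search written as a sum, so that [computed_sum] applies. The shift [c.+1] is that of
    [closed_names], where 0 enumerates nothing. *)
Definition enumerated (p : baire) (c n : nat) : bool :=
  0 < \sum_(i < n.+1) (p i == c.+1).

Definition candidate (p : baire) (n : nat) : nat :=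
  nat_rect (fun=> nat) 0 (fun m c => c + enumerated p c m) n.

Definition advances (p : baire) (n : nat) : bool :=
  enumerated p (candidate p n) n.

Lemma candidateS p n : candidate p n.+1 = candidate p n + advances p n.
Proof. by []. Qed.

Lemma enumeratedP p c n :
  reflect (exists2 i, i <= n & p i = c.+1) (enumerated p c n).
Proof.
rewrite /enumerated lt0n sum_nat_eq0 negb_forall.
apply: (iffP existsP) => [[j]|[i le_in pi]].
  by rewrite implyTb eqb0 negbK => /eqP pj; exists j; rewrite // -ltnS.
have lt_in : i < n.+1 by [].
by exists (Ordinal lt_in); rewrite /= pi eqxx.
Qed.

Section Correctness.
Variables (p : baire) (A : set nat).
Hypothesis pA : closed_names p A.

Lemma notin_closed_names c : ~ A c <-> exists i, p i = c.+1.
Proof.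
have -> : (~ A c) = [set c | exists2 n, 0 < p n & c = p n - 1] c.
  by rewrite -pA.
split=> [[n pn ->]|[i pi]]; first by exists n; rewrite subn1 prednK.
by exists i; rewrite pi ?subn1.
Qed.

(** The candidate leaves a number only once that number is enumerated, so it never passes an element
    of [A]. *)
Lemma candidate_le a n : A a -> candidate p n <= a.
Proof.
move=> Aa; elim: n => // n IHn; rewrite candidateS.
case: (boolP (advances p n)) => [/enumeratedP[i _ pi]|_]; last by rewrite addn0.
rewrite addn1 ltn_neqAle IHn andbT; apply/eqP => can.
by apply: (iffRL (notin_closed_names a)) Aa; exists i; rewrite -can.
Qed.

(** Each move raises the candidate by 1, so infinitely many moves would carry it past an element of
    [A]. *)
Lemma advances_finite : A !=set0 ->
  exists N, forall k, N <= k -> advances p k = false.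
Proof.
move=> [a Aa]; apply: contrapT => /forallNP inf.
have unbounded m : exists n, m <= candidate p n.
  elim: m => [|m [n le_mn]]; first by exists 0.
  have /existsNP[k /not_implyP[le_nk /eqP]] := inf n.
  rewrite eqbF_neg negbK => adv; exists k.+1; rewrite candidateS adv addn1 ltnS.
  apply: leq_trans le_mn _; elim: k le_nk {adv} => [|k IHk].
    by rewrite leqn0 => /eqP->.
  rewrite leq_eqVlt => /predU1P[->//|/IHk le].
  by rewrite candidateS (leq_trans le)// leq_addr.
have [n] := unbounded a.+1; rewrite leqNgt ltnS.
by rewrite candidate_le.
Qed.

Lemma candidate_in n :
  (forall k, n <= k -> advances p k = false) -> A (candidate p n).
Proof.
move=> stop; apply: contrapT => /notin_closed_names[i pi].
have stable k : n <= k -> candidate p k = candidate p n.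
  elim: k => [|k IHk]; first by rewrite leqn0 => /eqP->.
  rewrite leq_eqVlt => /predU1P[->//|nk].
  by rewrite candidateS stop// addn0 IHk.
(* At this stage the candidate is still the final one, and its enumeration at [i] has been seen. *)
suff : advances p (maxn n i) by rewrite stop ?leq_maxl.
apply/enumeratedP; exists i; first exact: leq_maxr.
by rewrite stable ?leq_maxl.
Qed.

End Correctness.

(** The format of [rat_monomial] stores the denominator minus 1; the absent last entry makes the
    exponent of the conjugate default to 0. *)
Definition term_code (p : baire) (k : nat) : nat :=
  CodeSeq.code [:: advances p k : nat; 0; 0; 0; (4 ^ k.+1).-1; k.+1].

(** The step is the coding formula for prepending a term to the list, so the terms appear in reverse
    order. *)
Definition sum_code (p : baire) (n : nat) : nat :=
  nat_rect (fun=> nat) 0 (fun k s => 2 ^ term_code p k * s.*2.+1) n.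

(** The entry 3 is both the index of the disk [U 3] and the bound on the modulus there. *)
Definition bound_name (p : baire) (n : nat) : nat :=
  if n is m.+1 then sum_code p m else 3.

Lemma decode_sum_code p n :
  CodeSeq.decode (sum_code p n) = rev [seq term_code p k | k <- iota 0 n].
Proof.
rewrite -[RHS]CodeSeq.codeK; congr CodeSeq.decode.
by elim: n => // n IHn; rewrite -(addn1 n) iotaD map_cat rev_cat addn1 /= -IHn.
Qed.

Section Computability.
Variables (I : Type) (o p : I -> baire) (a : I -> seq nat) (k : nat).
Hypothesis ak : forall i, size (a i) = k.
(* [p i] can be read off the oracle [o i]. *)
Hypothesis cp : forall J (h : J -> I) b F,
  computed (fun j => o (h j)) b F ->
  computed (fun j => o (h j)) b (fun j => p (h j) (F j)).

Lemma computed_candidate F : computed o a F ->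
  computed o a (fun i => candidate (p i) (F i)).
Proof.
move=> cF; apply: (computed_rec ak (F := F) (B := fun=> 0)
  (G := fun i m c => c + enumerated (p i) c m)) => //.
  exact: computed_const.
apply: computed_add; first proj 1.
apply: computed_leq; first exact: computed_const.
apply: (@computed_sum _ _ _ k.+2 _
  (fun x i => (p x.1.1 i == x.2.+1))) => [x /=||]; first by rewrite ak.
  by apply: computed_succ; proj 0.
apply: computed_eq; last by apply: computed_succ; proj 2.
by apply: (cp (h := fun x => x.1.1.1)); proj 0.
Qed.

Lemma computed_advances F : computed o a F ->
  computed o a (fun i => advances (p i) (F i)).
Proof.
move=> cF; pose G i := candidate (p i) (F i).+1 - candidate (p i) (F i).
apply: (computed_ext (F := G)) => [i|].
  by rewrite /G candidateS addKn.
by apply: computed_sub; apply: computed_candidate => //;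
  apply: computed_succ.
Qed.

End Computability.

Section ComputedCode.
Variables (I : Type) (o : I -> baire) (a : I -> seq nat).

Lemma computed_code_nil : computed o a (fun=> CodeSeq.code [::]).
Proof. exact: computed_const. Qed.

Lemma computed_code_cons F (L : I -> seq nat) :
  computed o a F -> computed o a (fun i => CodeSeq.code (L i)) ->
  computed o a (fun i => CodeSeq.code (F i :: L i)).
Proof.
move=> cF cL; apply: computed_mul.
  by apply: computed_expn => //; exact: computed_const.
apply: computed_succ; apply: (computed_ext (F := fun i =>
  CodeSeq.code (L i) + CodeSeq.code (L i))) => [i|]; first by rewrite addnn.
exact: computed_add.
Qed.

End ComputedCode.

Lemma computable_bound_name : computable1 (fun p => Some (bound_name p)).
Proof.
have [c cP] : computed (fun x : baire * nat => x.1) (fun x => [:: x.2])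
    (fun x => bound_name x.1 x.2).
  pose G (x : baire * nat) :=
    (0 < x.2) * sum_code x.1 x.2.-1 + ~~ (0 < x.2) * 3.
  apply: (computed_ext (F := G)) => [[p [|n]]|].
  - by rewrite /G mul0n.
  - by rewrite /G /= mul1n addn0.
  have c0 : computed (fun x : baire * nat => x.1) (fun x => [:: x.2])
      (fun x => 0 < x.2).
    by apply: computed_leq; [exact: computed_const|proj 0].
  apply: computed_add; apply: computed_mul => //; last exact: computed_const.
    apply: (@computed_rec 1 _ _ _ _ (fun x => x.2.-1) (fun=> 0)
      (fun x k s => 2 ^ term_code x.1 k * s.*2.+1)) => //.
    - by apply: computed_pred; proj 0.
    - exact: computed_const.
    (* Seen as prepending to the decoded accumulator, the step is built entry by entry with
       [computed_code_cons]. *)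
    apply: (computed_ext (F := fun x : baire * nat * nat * nat =>
      CodeSeq.code (term_code x.1.1.1 x.1.2 :: CodeSeq.decode x.2))) => [x|].
      by rewrite [CodeSeq.code _]/= CodeSeq.decodeK.
    apply: computed_code_cons; last first.
      apply: (@computed_proj _ _ _ 1) => x /=; by rewrite CodeSeq.decodeK.
    apply: computed_code_cons.
      apply: (@computed_advances _ _ (fun x => x.1.1.1) _ 3) => //.
      - by move=> J h b F; exact: computed_oracle.
      - proj 0.
    do 3 (apply: computed_code_cons; first exact: computed_const).
    apply: computed_code_cons.
      apply: computed_pred; apply: computed_expn; first exact: computed_const.
      by apply: computed_succ; proj 0.
    apply: computed_code_cons; last exact: computed_code_nil.
    by apply: computed_succ; proj 0.
  exact: computed_neg.
by exists c => p _ [<-] n; apply: (cP (p, n)).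
Qed.

Lemma computable_candidate :
  computable2 (fun p r => Some (fun=> candidate p (r 0))).
Proof.
have [c cP] : computed (fun x : baire * baire * nat => join x.1.1 x.1.2)
    (fun x => [:: x.2]) (fun x => candidate x.1.1 (x.1.2 0)).
  apply: (@computed_candidate _ _ (fun x => x.1.1) _ 1) => //.
  - by move=> J h b F; apply: (@computed_join_l J (fun j => (h j).1.1)).
  - by apply: computed_join_r; exact: computed_const.
by exists c => p q _ [<-] n; apply: (cP (p, q, n)).
Qed.

End ChoiceToBound.

(** * The polynomial recording the moves and its name *)

Section Analytic.
Variable R : realType.
Local Open Scope ring_scope.
Local Open Scope complex_scope.

(** The composition with ['X + z0%:P] has the Taylor coefficients at [z0]. The partial sums are
    eventually constant, so any radius works, here 1. *)
Lemma analytic_horner (P : {poly R[i]}) z0 : analytic_at (horner P) z0.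
Proof.
pose Q := P \Po ('X + z0%:P); exists (fun k => Q`_k), 1; split=> // z _.
apply: cvg_near_cst; exists (size Q) => // n /= le_n.
rewrite /series /= big_mkord -(horner_coef_wide _ le_n) horner_comp.
by rewrite !hornerE subrK.
Qed.

(** The radius of [U m] is at most 2, and a closure point lies within 1 of some point of the
    disk. *)
Lemma clU_le (m : nat) (z : R[i]) : @clU R m z -> `|z| <= 3.
Proof.
move=> /(_ (ball (z : R[i]^o) 1) (nbhsx_ballx _ _ ltr01)) [w []].
rewrite /U -!ball_normE /= sub0r normrN => w2 zw.
have -> : z = (z - w) + w by rewrite subrK.
have le2 : (2 `^ (m.+1%:R^-1) : R)%:C <= 2.
  have -> : (2 : R[i]) = (2 : R)%:C by rewrite rmorph_nat.
  by rewrite lecR ler1_powR ?ler1n// invf_le1 ?ler1n// ltr0n.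
rewrite (le_trans (ler_normD _ _))// (_ : 3 = 1 + 2) -?natrD//.
by rewrite lerD ?ltW// (lt_le_trans w2).
Qed.

Definition choice_poly (p : baire) (n : nat) : {poly R[i]} :=
  \sum_(k < n) ((advances p k)%:R / (4 ^ k.+1)%:R) *: 'X^(k.+1).

Lemma choice_polyE p n z : (choice_poly p n).[z] =
  \sum_(k < n) (advances p k)%:R / (4 ^ k.+1)%:R * z ^+ k.+1.
Proof.
rewrite horner_sum; apply: eq_bigr => k _.
by rewrite hornerZ hornerXn.
Qed.

Lemma coef_choice_poly p n k : (k < n)%N ->
  (choice_poly p n)`_k.+1 = (advances p k)%:R / (4 ^ k.+1)%:R.
Proof.
move=> kn; rewrite coef_sum (bigD1 (Ordinal kn))//= coefZ coefXn eqxx mulr1.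
rewrite big1 ?addr0// => j; rewrite -val_eqE /= coefZ coefXn eqSS eq_sym.
by move=> /negPf->; rewrite mulr0.
Qed.

Lemma rat_poly_sum_code p n z : rat_poly (sum_code p n) z = (choice_poly p n).[z].
Proof.
rewrite /rat_poly decode_sum_code (perm_big _ (permEl (perm_rev _))) big_map.
rewrite choice_polyE -(big_mkord xpredT (fun k =>
  (advances p k)%:R / (4 ^ k.+1)%:R * z ^+ k.+1)) /index_iota subn0.
apply: eq_bigr => k _; rewrite /rat_monomial /term_code CodeSeq.codeK /=.
rewrite prednK ?expn_gt0// expr0 mulr1 !subrr subr0; congr (_ / _ * _).
exact: (rmorph_nat (real_complex R)).
Qed.

(** Applied with [x = 1] for the approximation error on the unit disk and [x = 3] for the bound on
    the larger disk. *)
Lemma norm_choice_term p k (z : R[i]) (x : R) : `|z| <= x%:C ->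
  `|(advances p k)%:R / (4 ^ k.+1)%:R * z ^+ k.+1| <= ((x / 4) ^+ k.+1)%:C.
Proof.
move=> zx; rewrite rmorphXn rmorphM fmorphV rmorph_nat.
rewrite expr_div_n [leRHS]mulrC.
rewrite -[X in _ <= X]mul1r mulrA normrM normrX ler_pM ?lerXn2r ?nnegrE//.
  rewrite normrM normfV natrX normrX !normr_nat ler_pM ?invr_ge0//.
  by case: (advances p k).
exact: le_trans zx.
Qed.

Lemma geometric_sum (x : R) (m n : nat) : (m <= n)%N ->
  (1 - x) * \sum_(m <= k < n) x ^+ k.+1 = x * (x ^+ m - x ^+ n).
Proof.
elim: n => [|n IHn].
  by rewrite leqn0 => /eqP->; rewrite big_geq// subrr !mulr0.
rewrite leq_eqVlt => /predU1P[->|]; first by rewrite big_geq// subrr !mulr0.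
rewrite ltnS => le_mn; rewrite big_nat_recr//= mulrDr IHn// !exprS.
by ring.
Qed.

Lemma geometric_quarter (m n : nat) : (m <= n)%N ->
  \sum_(m <= k < n) 4^-1 ^+ k.+1 <= 4^-1 ^+ m / 3 :> R.
Proof.
move=> le_mn; have := geometric_sum (4^-1) le_mn.
have : 0 <= (4^-1 : R) ^+ n by rewrite exprn_ge0.
lra.
Qed.

Lemma geometric_three_quarters n :
  \sum_(0 <= k < n) (3 / 4) ^+ k.+1 <= 3 :> R.
Proof.
have := geometric_sum (3 / 4) (leq0n n); rewrite expr0.
have : 0 <= (3 / 4 : R) ^+ n by rewrite exprn_ge0//; lra.
lra.
Qed.

Lemma choice_poly_dist p m n z : (m <= n)%N -> closed_disk z ->
  normc ((choice_poly p n).[z] - (choice_poly p m).[z]) <= 4^-1 ^+ m / 3 :> R.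
Proof.
move=> le_mn z1; rewrite -lec_normc !choice_polyE -!(big_mkord xpredT
  (fun k => (advances p k)%:R / (4 ^ k.+1)%:R * z ^+ k.+1)).
rewrite (big_cat_nat (leq0n m) le_mn)//= addrAC subrr add0r.
rewrite (le_trans (ler_norm_sum _ _ _))//.
have zx : `|z| <= (1 : R)%:C by [].
rewrite (le_trans (ler_sum _ (fun k _ => norm_choice_term p k zx)))//.
rewrite -rmorph_sum lecR (eq_bigr (fun k => 4^-1 ^+ k.+1)) => [|k _].
  exact: geometric_quarter.
by rewrite mul1r.
Qed.

Lemma choice_poly_bound p n z : @clU R 3 z -> `|(choice_poly p n).[z]| <= 3.
Proof.
move=> /clU_le z3; rewrite choice_polyE -(big_mkord xpredT
  (fun k => (advances p k)%:R / (4 ^ k.+1)%:R * z ^+ k.+1)).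
rewrite (le_trans (ler_norm_sum _ _ _))//.
have n3 : (3 : R[i]) = (3 : R)%:C by rewrite rmorph_nat.
have zx : `|z| <= (3 : R)%:C by rewrite -n3.
rewrite (le_trans (ler_sum _ (fun k _ => norm_choice_term p k zx)))//.
by rewrite -rmorph_sum n3 lecR geometric_three_quarters.
Qed.

Lemma horner_analyticD (P : {poly R[i]}) :
  exists g, analytic_ext (@closed_disk R) (fun z => P.[val z]) g.
Proof. by exists (horner P); split=> // z _; exact: analytic_horner. Qed.

Definition polyD (P : {poly R[i]}) : analyticD R :=
  exist _ (fun z => P.[val z]) (horner_analyticD P).

(** The [n]-th partial sum misses only a geometric tail of at most [4^-n / 3], strictly less than
    [2^-n]; from [N] on the partial sums no longer change. *)
Lemma analytic_names_choice p N :
  (forall k, (N <= k)%N -> advances p k = false) ->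
  analytic_names (bound_name p) (polyD (choice_poly p N)).
Proof.
move=> stop; split.
  exists (horner (choice_poly p N)); split; last exact: choice_poly_bound.
  by split=> // z _; exact: analytic_horner.
move=> n; rewrite /= /sup_dist.
apply: (@le_lt_trans _ _ (4^-1 ^+ n / 3)%:E); last first.
  rewrite lte_fin.
  have : 0 < (4^-1 : R) ^+ n by rewrite exprn_gt0.
  have : (4^-1 : R) ^+ n <= 2^-1 ^+ n by rewrite lerXn2r ?nnegrE//; lra.
  lra.
apply/ereal_supP => _ [[z zD] _ <-] /=; rewrite lee_fin rat_poly_sum_code.
have z1 : closed_disk z by move: zD; rewrite inE.
have [le_nN|/ltnW le_Nn] := leqP n N; first exact: choice_poly_dist.
have -> : choice_poly p n = choice_poly p N.
  rewrite /choice_poly -!(big_mkord xpredT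
    (fun k => ((advances p k)%:R / (4 ^ k.+1)%:R) *: 'X^(k.+1))).
  rewrite (big_cat_nat (leq0n N) le_Nn)//= [X in _ + X]big_nat_cond.
  rewrite [X in _ + X]big1 ?addr0//.
  by move=> k /andP[/andP[/stop-> _] _]; rewrite mul0r scale0r.
by rewrite subrr normc0 divr_ge0 ?exprn_ge0.
Qed.

End Analytic.

(** * The remaining reductions and the equivalences *)

Lemma C_nat_le_dbnd_omega (R : realType) : weihrauch_le C_nat (dbnd_omega R).
Proof.
exists (fun p => Some (bound_name p)).
exists (fun p r => Some (fun=> candidate p (r 0%N))).
split; [exact: computable_bound_name|exact: computable_candidate|].
move=> G Gb p A pA A0; have [N stop] := advances_finite pA A0.
pose f := polyD (choice_poly R p N).
have [|r [n [Gr rn [P fP degP]]]] := Gb _ f (analytic_names_choice R stop).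
  by exists (size (choice_poly R p N)).-1; exists (choice_poly R p N).
exists (fun=> candidate p (r 0%N)), (candidate p n); split=> //=.
- by rewrite Gr.
- by rewrite /nat_names rn.
(* Stage [k] is recorded in the coefficient of exponent [k.+1], so a move at some [k >= n] would
   force a degree above the bound [n]. *)
suff adv0 k : (n <= k)%N -> advances p k = false.
  by have := candidate_in pA adv0.
move=> le_nk; have [/stop//|kN] := leqP N k.
have PE : choice_poly R p N = P by apply: (@poly_restr_inj _ f).
have := coef_choice_poly R p kN; rewrite PE nth_default; last first.
  by move: degP; case: (size P) => //= s le_sn; rewrite ltnS (leq_trans le_sn).
case: (advances p k) => // /esym/eqP.
by rewrite mul1r invr_eq0 pnatr_eq0 expn_eq0.
Qed.

(** The degree is itself a valid bound, so names and answers pass through unchanged. *)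
Lemma dbnd_omega_le_deg_omega (R : realType) :
  weihrauch_le (dbnd_omega R) (deg_omega R).
Proof.
exists Some, (fun _ => Some); split.
- exists Oracle => p _ [<-] n; exact: eval_oracle.
- have [c cP] : computed (fun x : baire * baire * nat => join x.1.1 x.1.2)
      (fun x => [:: x.2]) (fun x => x.1.2 x.2).
    by apply: computed_join_r; proj 0.
  by exists c => p q _ [<-] n; apply: (cP (p, q, n)).
- move=> G Gd p f pf [n [P fP _]].
  have [|r [m [Gr rm [Q fQ mQ]]]] := Gd p f pf.
    by exists (size P).-1; exists P.
  exists r, m; split=> //=; first by rewrite Gr.
  by exists Q => //; rewrite mQ.
Qed.

Theorem theorem3p5 (R : realType) :
  weihrauch_equiv C_nat (dbnd_omega R) /\
  weihrauch_equiv (dbnd_omega R) (deg_omega R).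
Proof.
have Cb := C_nat_le_dbnd_omega R.
have bd := dbnd_omega_le_deg_omega R.
have dC := deg_omega_le_C_nat R.
(* The three reductions form a cycle, and each missing converse follows by going round it. *)
by split; split=> //; [apply: weihrauch_le_trans bd dC|
  apply: weihrauch_le_trans dC Cb].
Qed.
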